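(* Consider the state-dependent DMC with causal CSI at the transmitter described in the context. For every $R_K\geq 0$ and $B\geq 0$, the covert capacity with causal CSI satisfies $$C_{\mathrm{c}}\geq \max I(V;Y),$$ where the maximum is over PMFs $P_V$ on a finite set $\mathcal{V}$ with $|\mathcal{V}|\leq \min\{|\mathcal{X}|+|\mathcal{Y}|+|\mathcal{Z}|-1,\ (|\mathcal{X}|-1)\cdot|\mathcal{S}|+2\}$ and functions $x:\mathcal{V}\times\mathcal{S}\to\mathcal{X}$, evaluated under the joint distribution $P_S(s)P_V(v)\mathbbm{1}\{x=x(v,s)\}P_{Y,Z|S,X}(y,z|s,x)$, subject to $P_Z=Q_0$, $\mathrm{E}[b(X)]\leq B$, and $I(V;Z)-I(V;Y)<R_K$.
   Context: A state-dependent discrete memoryless channel consists of finite alphabets $\mathcal{X}$ (input), $\mathcal{S}$ (state), $\mathcal{Y}$ (receiver output), $\mathcal{Z}$ (warden output), a state PMF $P_S$, and a channel law $P_{Y,Z|S,X}$. Over $n$ uses, the state sequence $S^n$ is IID $\sim P_S$, and given $(X^n,S^n)$ the pairs $(Y_i,Z_i)$ are conditionally independent with law $P_{Y,Z|S,X}(\cdot,\cdot|S_i,X_i)$. A designated ''no input'' symbol $x_0\in\mathcal{X}$ is fixed, and $Q_0(z)=\sum_{s}P_S(s)P_{Z|S,X}(z|s,x_0)$; $Q_0^{\times n}$ is its $n$-fold product. It is assumed that $\mathrm{supp}(Q_0)=\mathcal{Z}$. A cost function $b:\mathcal{X}\to[0,\infty)$ is given, with $b(x^n)=\frac1n\sum_{i=1}^n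 b(x_i)$. A secret key $K$ uniform on $[1:2^{nR_K}]$ and a message $M$ uniform on $[1:2^{nR}]$ are mutually independent and independent of $S^n$; $K$ is known to transmitter and receiver, while $S^n$ is known only to the transmitter. With causal CSI, an $(2^{nR},2^{nR_K},n)$ code consists of an encoder producing $X_i$ as a function of $(M,K,S^i)$ (and possibly private randomness of the transmitter independent of $(M,K,S^n)$), $i\in[1:n]$, and a decoder mapping $(Y^n,K)$ to $\hat M$. With noncausal CSI, the encoder produces $X^n$ from $(M,K,S^n)$ (and possibly such private randomness). $P_e^{(n)}=P(\hat M\neq M)$, and $\widehat{P}_{Z^n}$ is the distribution of the warden's output $Z^n$ induced by the code. A rate $R$ is achievable (for given $R_K,B$) if there is a sequence of codes with $\limsup_{n}\mathrm{E}[b(X^n)]\leq B$, $P_e^{(n)}\to 0$, and $D(\widehat{P}_{Z^n}\|Q_0^{\times n})\to 0$. The covert capacity $C_{\mathrm{c}}$ (causal CSI) resp. $C_{\mathrm{nc}}$ (noncausal CSI) is the supremum of achievable rates. *)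

(* Defs.v *)
From Stdlib Require Import Reals ZArith.
From HB Require Import structures.
From mathcomp Require Import all_boot.
Set Implicit Arguments. Unset Strict Implicit. Unset Printing Implicit Defensive.
Local Open Scope R_scope.

Definition rsum (T : finType) (f : T -> R) : R :=
  \big[Rplus/R0]_(t : T) f t.
Definition rprod (n : nat) (f : 'I_n -> R) : R :=
  \big[Rmult/R1]_(i < n) f i.

Definition log2 (x : R) : R := ln x / ln 2.

Definition is_pmf (T : finType) (p : T -> R) : Prop :=
  (forall t, 0 <= p t) /\ rsum p = 1.

Definition is_channel (S X Y Z : finType) (W : S -> X -> Y -> Z -> R) : Prop :=
  forall s x, (forall y z, 0 <= W s x y z) /\
              rsum (fun yz : Y * Z => W s x yz.1 yz.2) = 1.

Definition mutinf (A B : finType) (J : A -> B -> R) : R :=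
  rsum (fun a => rsum (fun b =>
    if Rlt_dec 0 (J a b)
    then J a b * log2 (J a b / (rsum (fun b' => J a b') * rsum (fun a' => J a' b)))
    else 0)).

Definition kl (T : finType) (p q : T -> R) : R :=
  rsum (fun t => if Rlt_dec 0 (p t) then p t * log2 (p t / q t) else 0).

Section Model.
Variables (X S Y Z : finType) (PS : S -> R) (W : S -> X -> Y -> Z -> R).

Definition Q0 (x0 : X) (z : Z) : R :=
  rsum (fun s => PS s * rsum (fun y => W s x0 y z)).

(* single-letter quantities under P_S(s) P_V(v) 1{x = xf v s} P_{YZ|SX} *)
Definition PVY (V : finType) (PV : V -> R) (xf : V -> S -> X) (v : V) (y : Y) : R :=
  rsum (fun s => PS s * PV v * rsum (fun z => W s (xf v s) y z)).
Definition PVZ (V : finType) (PV : V -> R) (xf : V -> S -> X) (v : V) (z : Z) : R :=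
  rsum (fun s => PS s * PV v * rsum (fun y => W s (xf v s) y z)).
Definition PZ (V : finType) (PV : V -> R) (xf : V -> S -> X) (z : Z) : R :=
  rsum (fun v => PVZ PV xf v z).
Definition Eb (b : X -> R) (V : finType) (PV : V -> R) (xf : V -> S -> X) : R :=
  rsum (fun v => rsum (fun s => PS s * PV v * b (xf v s))).

(* An (M, K, n) code with causal CSI: the encoder may use private randomness
   (a random variable on a finite type with an arbitrary PMF); X_i depends on
   (M, K, S^i, randomness) only. *)
Record code (n M K : nat) := Code {
  rnd : finType;
  rnd_pmf : rnd -> R;
  rnd_pmf_ok : is_pmf rnd_pmf;
  enc : 'I_n -> 'I_M -> 'I_K -> {ffun 'I_n -> S} -> rnd -> X;
  enc_causal : forall (i : 'I_n) (m : 'I_M) (k : 'I_K) (w : rnd) (s s' : {ffun 'I_n -> S}),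
      (forall j : 'I_n, (j <= i)%N -> s j = s' j) ->
      enc i m k s w = enc i m k s' w;
  dec : {ffun 'I_n -> Y} -> 'I_K -> 'I_M
}.

Arguments rnd_pmf [n M K] c _.
Arguments enc [n M K] c _ _ _ _ _.
Arguments enc_causal [n M K] c _ _ _ _ _ _ _.
Variables (n M K : nat) (c : code n M K).

Definition weight (m : 'I_M) (k : 'I_K) (w : rnd c) (s : {ffun 'I_n -> S})
    (y : {ffun 'I_n -> Y}) (z : {ffun 'I_n -> Z}) : R :=
  / INR M * / INR K * rnd_pmf c w *
  rprod (fun i => PS (s i) * W (s i) (enc c i m k s w) (y i) (z i)).

Definition Pe : R :=
  rsum (fun m => rsum (fun k => rsum (fun w => rsum (fun s => rsum (fun y => rsum (fun z =>
    if dec c y k == m then 0 else weight m k w s y z)))))).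

Definition Phat (z : {ffun 'I_n -> Z}) : R :=
  rsum (fun m => rsum (fun k => rsum (fun w => rsum (fun s => rsum (fun y =>
    weight m k w s y z))))).

Definition Ebn (b : X -> R) : R :=
  rsum (fun m : 'I_M => rsum (fun k : 'I_K => rsum (fun w => rsum (fun s : {ffun 'I_n -> S} =>
    / INR M * / INR K * rnd_pmf c w * rprod (fun i => PS (s i)) *
    (/ INR n * rsum (fun i : 'I_n => b (enc c i m k s w))))))).

End Model.

(* size of the index set [1 : 2^{n r}]: the ceiling of 2^{n r} *)
Definition nsize (n : nat) (r : R) : nat :=
  Z.to_nat (1 - up (- Rpower 2 (INR n * r)))%Z.

Definition achievable_causal (X S Y Z : finType) (PS : S -> R)
    (W : S -> X -> Y -> Z -> R) (x0 : X) (b : X -> R) (B RK r : R) : Prop :=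
  exists c : forall n : nat, code X S Y n (nsize n r) (nsize n RK),
    (forall eps, 0 < eps -> exists N : nat, forall n : nat, (N <= n)%nat ->
        @Ebn X S Y PS _ _ _ (c n) b <= B + eps) /\
    Un_cv (fun n => Pe PS W (c n)) 0 /\
    Un_cv (fun n => kl (Phat PS W (c n))
                       (fun z : {ffun 'I_n -> Z} => rprod (fun i => Q0 PS W x0 (z i)))) 0.

(* "sup A >= v" (supremum in the extended reals) *)
Definition sup_ge (A : R -> Prop) (v : R) : Prop :=
  forall eps, 0 < eps -> exists r, A r /\ v - eps < r.

(* Main.v *)
Require Import Defs.
From Stdlib Require Import Reals ZArith Lra ClassicalEpsilon FunctionalExtensionality.
From HB Require Import structures.
From mathcomp Require Import all_boot.
(** Draw a codebook of [M * K] i.i.d. codewords with law [PV^n] and let the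
    encoder apply the Shannon strategies [xf (v_i, -)] to the current states, so
    that the receiver and the warden see memoryless channels from [V].

    The expected error probability of the threshold decoder is at most
    [P (i(V;Y) <= n gamma) + (M - 1) exp (- n gamma)].  The warden's output has
    expected divergence at most [E log (1 + exp i(V;Z) / (M K))], by Jensen's
    inequality over the other codewords and [PZ = Q0].  As [ln (1 + x) <= x^lam / lam],
    both bounds become [n]-th powers of the single-letter moments
    [E exp (lam h)] with [E h < 0], which are smaller than [1] for small [lam];
    no typicality argument is needed.

    A single codebook serves the three requirements because it can be chosen so
    that [Pe + KL + tau^n * cost] is at most its mean, with [tau < 1] decaying so
    slowly that [Pe + KL = O(tau^(2n))] on average: then [Pe + KL = O(tau^n)]
    and [cost <= E b(X) + O(tau^n)]. *)

Set Implicit Arguments. Unset Strict Implicit. Unset Printing Implicit Defensive.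
Local Open Scope R_scope.

(** * Real sums and products as big operators *)

HB.instance Definition _ := Monoid.isComLaw.Build R 0 Rplus
  (fun x y z => esym (Rplus_assoc x y z)) Rplus_comm Rplus_0_l.
HB.instance Definition _ := Monoid.isComLaw.Build R 1 Rmult
  (fun x y z => esym (Rmult_assoc x y z)) Rmult_comm Rmult_1_l.
HB.instance Definition _ := Monoid.isMulLaw.Build R 0 Rmult
  Rmult_0_l Rmult_0_r.
HB.instance Definition _ := Monoid.isAddLaw.Build R Rmult Rplus
  Rmult_plus_distr_r Rmult_plus_distr_l.

Section FiniteSums.
Variables (T : finType).
Implicit Types (f g : T -> R).

Lemma rsum_ext f g : (forall t, f t = g t) -> rsum f = rsum g.
Proof. by move=> H; apply: eq_bigr => t _. Qed.

Lemma rsum_ge0 f : (forall t, 0 <= f t) -> 0 <= rsum f.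
Proof.
move=> H; rewrite /rsum; apply: (big_ind (fun x => 0 <= x)) => //; first lra.
by move=> x y; lra.
Qed.

Lemma rsum_le f g : (forall t, f t <= g t) -> rsum f <= rsum g.
Proof.
move=> H; rewrite /rsum; apply: (big_ind2 (fun x y => x <= y)) => //; first lra.
by move=> *; lra.
Qed.

Lemma rsum_mull c f : c * rsum f = rsum (fun t => c * f t).
Proof. exact: big_distrr. Qed.

Lemma rsum_mulr c f : rsum f * c = rsum (fun t => f t * c).
Proof. exact: big_distrl. Qed.

Lemma rsumD f g : rsum (fun t => f t + g t) = rsum f + rsum g.
Proof. exact: big_split. Qed.

Lemma rsumB f g : rsum (fun t => f t - g t) = rsum f - rsum g.
Proof.
rewrite /Rminus; have -> : - rsum g = -1 * rsum g by lra.
by rewrite rsum_mull -rsumD; apply: rsum_ext => t; lra.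
Qed.

Lemma rsum_const c : rsum (fun _ : T => c) = INR #|T| * c.
Proof.
rewrite /rsum big_const; elim: #|T| => [|n IH]; first by rewrite /= Rmult_0_l.
by rewrite iterS IH S_INR; lra.
Qed.

Lemma rsum_delta t0 f : rsum (fun t => if t == t0 then f t else 0) = f t0.
Proof. by rewrite /rsum -big_mkcond big_pred1_eq. Qed.

Lemma rsum_ge_term f t0 : (forall t, 0 <= f t) -> f t0 <= rsum f.
Proof.
move=> H; rewrite -[f t0](rsum_delta t0); apply: rsum_le => t.
by case: ifP => _; [lra | exact: H].
Qed.

(** First-moment argument: if [f] exceeded [c] everywhere, the positive mass that [p] puts somewhere
    would push the mean strictly above [c]. It later extracts one codebook from the random
    ensemble. *)
Lemma rsum_exists_le f (p : T -> R) c :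
  is_pmf p -> rsum (fun t => p t * f t) <= c -> exists t, f t <= c.
Proof.
case=> p0 p1 H; apply: NNPP => Hn.
have Hf t : c < f t by case: (Rle_lt_dec (f t) c) => // ?; case: Hn; exists t.
have [t pt] : exists t, 0 < p t.
  apply: NNPP => Hp; have : rsum p <= rsum (fun _ : T => 0).
    by apply: rsum_le => t; case: (Rle_lt_dec (p t) 0) => // ?; case: Hp; exists t.
  by rewrite rsum_const p1; lra.
have Hge u : 0 <= p u * (f u - c) by apply: Rmult_le_pos; [exact: p0 | have := Hf u; lra].
have := rsum_ge_term t Hge.
have -> : rsum (fun u => p u * (f u - c)) = rsum (fun u => p u * f u) - c.
  rewrite -[c in RHS]Rmult_1_l -p1 rsum_mulr -rsumB.
  by apply: rsum_ext => u; lra.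
have : 0 < p t * (f t - c) by apply: Rmult_lt_0_compat => //; have := Hf t; lra.
by lra.
Qed.

End FiniteSums.

Lemma rsum_unit (f : unit -> R) : rsum f = f tt.
Proof. by rewrite /rsum (big_pred1 tt) // => -[]. Qed.

Lemma rsum_exchange (A B : finType) (f : A -> B -> R) :
  rsum (fun a => rsum (fun b => f a b)) = rsum (fun b => rsum (fun a => f a b)).
Proof. exact: exchange_big. Qed.

Lemma rsum_pair (A B : finType) (f : A * B -> R) :
  rsum f = rsum (fun a => rsum (fun b => f (a, b))).
Proof.
rewrite /rsum (pair_bigA _ (fun a b => f (a, b))).
by apply: eq_bigr => -[].
Qed.

Lemma rprod_rsum (n : nat) (T : finType) (f : 'I_n -> T -> R) :
  rprod (fun i => rsum (f i)) =
  rsum (fun t : {ffun 'I_n -> T} => rprod (fun i => f i (t i))).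
Proof. exact: bigA_distr_bigA. Qed.

Section FiniteProducts.
Variables (n : nat).
Implicit Types (f g : 'I_n -> R).

Lemma rprod_ext f g : (forall i, f i = g i) -> rprod f = rprod g.
Proof. by move=> H; apply: eq_bigr => i _. Qed.

Lemma rprodM f g : rprod (fun i => f i * g i) = rprod f * rprod g.
Proof. exact: big_split. Qed.

Lemma rprod_gt0 f : (forall i, 0 < f i) -> 0 < rprod f.
Proof.
move=> H; rewrite /rprod; apply: (big_ind (fun x => 0 < x)) => //; first lra.
by move=> x y; apply: Rmult_lt_0_compat.
Qed.

Lemma rprod_ge0 f : (forall i, 0 <= f i) -> 0 <= rprod f.
Proof.
move=> H; rewrite /rprod; apply: (big_ind (fun x => 0 <= x)) => //; first lra.
by move=> x y; apply: Rmult_le_pos.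
Qed.

Lemma rprod_const c : rprod (fun _ : 'I_n => c) = c ^ n.
Proof.
rewrite /rprod big_const card_ord; elim: n => // k IH.
by rewrite iterS IH.
Qed.

Lemma rprod_neq0 f : rprod f <> 0 -> forall i, f i <> 0.
Proof.
move=> H i fi; apply: H; rewrite /rprod (bigD1 i) //= fi; exact: Rmult_0_l.
Qed.

Lemma rprod_exp f : rprod (fun i => exp (f i)) = exp (rsum f).
Proof.
rewrite /rprod /rsum; apply: (big_ind2 (fun x y => x = exp y)) => //.
- by rewrite exp_0.
- by move=> x1 y1 x2 y2 -> ->; rewrite exp_plus.
Qed.

End FiniteProducts.

(** * Product laws and their one- and two-coordinate marginals *)

Section ProductPmf.
Variables (I T : finType) (p : T -> R).
Hypothesis Hp : is_pmf p.

(** The index type is arbitrary because the same law serves twice: over ['I_n] for a word of i.i.d.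
    letters, and over ['I_M * 'I_K] for a codebook of i.i.d. words. *)
Definition prodpmf (C : {ffun I -> T}) : R := \big[Rmult/R1]_(i : I) p (C i).

Lemma rsum_prodpmf (h : I -> T -> R) :
  rsum (fun C => prodpmf C * \big[Rmult/R1]_(i : I) h i (C i)) =
  \big[Rmult/R1]_(i : I) rsum (fun t => p t * h i t).
Proof.
rewrite /rsum bigA_distr_bigA; apply: eq_bigr => C _.
by rewrite /prodpmf -big_split.
Qed.

Lemma prodpmf_is_pmf : is_pmf prodpmf.
Proof.
case: Hp => p0 p1; split.
  move=> C; rewrite /prodpmf; apply: (big_ind (fun x => 0 <= x)) => //; first lra.
  by move=> x y; apply: Rmult_le_pos.
rewrite (@rsum_ext _ _ (fun C => prodpmf C * \big[Rmult/R1]_(i : I) 1)); last first.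
  by move=> C; rewrite big1_eq Rmult_1_r.
rewrite (rsum_prodpmf (fun _ _ => 1)) big1 // => i _.
by rewrite -[RHS]p1; apply: rsum_ext => t; lra.
Qed.

Lemma prodpmf_marginal (i : I) (g : T -> R) :
  rsum (fun C => prodpmf C * g (C i)) = rsum (fun t => p t * g t).
Proof.
case: Hp => p0 p1.
pose h j t := if j == i then g t else 1.
rewrite (@rsum_ext _ _ (fun C => prodpmf C * \big[Rmult/R1]_(j : I) h j (C j))).
  rewrite rsum_prodpmf (bigD1 i) //= big1 ?Rmult_1_r.
    by apply: rsum_ext => t; rewrite /h eqxx.
  move=> j ji; rewrite -[RHS]p1; apply: rsum_ext => t.
  by rewrite /h (negbTE ji); lra.
move=> C; rewrite (bigD1 i) //= big1 ?Rmult_1_r; first by rewrite /h eqxx.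
by move=> j ji; rewrite /h (negbTE ji).
Qed.

(** As [g] need not factor, it is expanded in point indicators [d t] and [d u] of the two
    coordinates. Each pair of indicators is a product over all coordinates ([h]), whose mean
    factors, the remaining coordinates contributing 1. *)
Lemma prodpmf_marginal2 (i j : I) (g : T -> T -> R) : i != j ->
  rsum (fun C => prodpmf C * g (C i) (C j)) =
  rsum (fun t => p t * rsum (fun u => p u * g t u)).
Proof.
case: Hp => p0 p1 ij.
pose d (t x : T) := if x == t then 1 else 0.
pose h t u l x := (if l == i then d t x else 1) * (if l == j then d u x else 1).
have Hd (t : T) f : rsum (fun x => f x * d t x) = f t.
  rewrite -[RHS](rsum_delta t); apply: rsum_ext => x.
  by rewrite /d; case: ifP => _; lra.
have Hprod t u C : \big[Rmult/R1]_(l : I) h t u l (C l) = d t (C i) * d u (C j).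
  rewrite big_split /=; congr (_ * _).
    rewrite (bigD1 i) //= eqxx big1 ?Rmult_1_r // => l li.
    by rewrite (negbTE li).
  rewrite (bigD1 j) //= eqxx big1 ?Rmult_1_r // => l lj.
  by rewrite (negbTE lj).
have E t u : rsum (fun C => prodpmf C * (d t (C i) * d u (C j))) = p t * p u.
  rewrite (@rsum_ext _ _ (fun C => prodpmf C * \big[Rmult/R1]_(l : I) h t u l (C l))).
    rewrite rsum_prodpmf (bigD1 i) //= (bigD1 j) 1?eq_sym //= big1 ?Rmult_1_r.
      congr (_ * _).
        rewrite -(Hd t p); apply: rsum_ext => x; rewrite /h eqxx (negbTE ij); lra.
      rewrite -(Hd u p); apply: rsum_ext => x.
      by rewrite /h eqxx eq_sym (negbTE ij); lra.
    move=> l /andP[li lj]; rewrite -[RHS]p1; apply: rsum_ext => x.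
    by rewrite /h (negbTE li) (negbTE lj); lra.
  by move=> C; rewrite Hprod.
transitivity (rsum (fun t => rsum (fun u => g t u *
    rsum (fun C => prodpmf C * (d t (C i) * d u (C j)))))).
  transitivity (rsum (fun C => rsum (fun t => rsum (fun u =>
      g t u * (prodpmf C * (d t (C i) * d u (C j))))))).
    apply: rsum_ext => C.
    rewrite (@rsum_ext _ _ (fun t => (prodpmf C * g t (C j)) * d (C i) t)) ?Hd //.
    move=> t; rewrite (@rsum_ext _ _ (fun u => (prodpmf C * g t u * d t (C i)) * d (C j) u)).
      by rewrite Hd /d eq_sym; lra.
    by move=> u; rewrite /d (eq_sym u); lra.
  rewrite rsum_exchange; apply: rsum_ext => t.
  rewrite rsum_exchange; apply: rsum_ext => u.
  by rewrite rsum_mull.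
apply: rsum_ext => t; rewrite rsum_mull; apply: rsum_ext => u.
by rewrite E; lra.
Qed.

End ProductPmf.

(** * Logarithm inequalities and nonnegativity of divergence *)

Lemma ln2_gt0 : 0 < ln 2.
Proof. by rewrite -ln_1; apply: ln_increasing; lra. Qed.

Lemma ln_le_sub1 x : 0 < x -> ln x <= x - 1.
Proof.
move=> x0; have := exp_ineq1_le (ln x).
by rewrite exp_ln //; lra.
Qed.

(** Concavity of [ln], as the tangent at [a]. Being affine in [x], the bound can be averaged
    exactly, which is how Jensen's inequality is carried out below. *)
Lemma ln_tangent x a : 0 < x -> 0 < a -> ln x <= ln a + x / a - 1.
Proof.
move=> x0 a0.
have xa : 0 < x / a by apply: Rdiv_lt_0_compat.
have {1}-> : x = a * (x / a) by field; lra.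
by rewrite ln_mult //; have := ln_le_sub1 xa; lra.
Qed.

(** Gibbs' inequality: [ln x <= x - 1] at [x = q t / p t] bounds each term below by
    [(p t - q t) / ln 2], and these bounds sum to 0. Where [p t = 0] the bound is negative and the
    term is 0. *)
Lemma kl_ge0 (T : finType) (p q : T -> R) :
  is_pmf p -> (forall t, 0 < q t) -> rsum q = 1 -> 0 <= kl p q.
Proof.
move=> [p0 p1] q0 q1; have l2 := ln2_gt0.
have H : rsum (fun t => (p t - q t) * / ln 2) <= kl p q.
  apply: rsum_le => t; case: Rlt_dec => pt /=; last first.
    have {pt} -> : p t = 0 by have := p0 t; lra.
    have := q0 t; have : 0 < / ln 2 by apply: Rinv_0_lt_compat.
    by move=> ? ?; have := Rmult_lt_0_compat (q t) (/ ln 2); lra.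
  rewrite /log2 /Rdiv -Rmult_assoc; apply: Rmult_le_compat_r.
    by apply/Rlt_le/Rinv_0_lt_compat.
  have qt := q0 t.
  have qp : 0 < q t / p t by apply: Rdiv_lt_0_compat.
  have -> : p t * / q t = / (q t / p t) by field; lra.
  rewrite ln_Rinv //; have := ln_le_sub1 qp => Hl.
  have -> : p t - q t = p t * (- (q t / p t - 1)) by field; lra.
  by apply: Rmult_le_compat_l; lra.
by move: H; rewrite -rsum_mulr rsumB p1 q1; lra.
Qed.

(** * One-shot soft covering for a random codebook *)

Section OneShot.
Variables (A U : finType) (p : A -> R) (G : A -> U -> R).
Hypotheses (Hp : is_pmf p) (HG : forall a, is_pmf (G a)).

Definition outpmf (u : U) : R := rsum (fun a => p a * G a u).
Local Notation q := outpmf.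

Lemma outpmf_is_pmf : is_pmf q.
Proof.
case: Hp => p0 p1; split=> [u|].
  by apply: rsum_ge0 => a; apply: Rmult_le_pos; [exact: p0 | exact: (HG a).1].
rewrite /outpmf rsum_exchange -[RHS]p1; apply: rsum_ext => a.
by rewrite -rsum_mull (HG a).2; lra.
Qed.

(* Expected tangent-line bound: the codewords other than [C i] enter only
   through their mean, which is where pairwise independence is used. *)
Lemma soft_covering_term (I : finType) (i : I) (u : U) :
  0 < q u ->
  let L := INR #|I| in let w a := 1 + G a u / (L * q u) in
  rsum (fun C => prodpmf p C * (G (C i) u *
    (ln (w (C i)) + / L * rsum (fun j : I => G (C j) u) / q u / w (C i) - 1)))
  <= rsum (fun a => p a * (G a u * ln (w a))).
Proof.
move=> qu L w; case: (Hp) => p0 p1.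
have L0 : 0 < L.
  by apply: lt_0_INR; apply/ltP; apply/card_gt0P; exists i.
have G0 a : 0 <= G a u by exact: (HG a).1.
have w1 a : 1 <= w a.
  have : 0 <= G a u / (L * q u); last by rewrite /w; lra.
  by apply: Rle_mult_inv_pos => //; apply: Rmult_lt_0_compat.
have wi a : 0 < / w a by apply: Rinv_0_lt_compat; have := w1 a; lra.
pose f a b := G a u * / w a * (G b u * / (L * q u)).
have f0 a b : 0 <= f a b.
  apply: Rmult_le_pos; apply: Rmult_le_pos => //; first by have := wi a; lra.
  by apply/Rlt_le/Rinv_0_lt_compat/Rmult_lt_0_compat.
transitivity (rsum (fun C => prodpmf p C * (G (C i) u * (ln (w (C i)) - 1))) +
   rsum (fun j => rsum (fun C => prodpmf p C * f (C i) (C j)))).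
  apply: Req_le; rewrite rsum_exchange -rsumD; apply: rsum_ext => C.
  rewrite -rsum_mull -Rmult_plus_distr_l; congr (_ * _).
  rewrite -rsum_mull -rsum_mulr; have := w1 (C i) => ?; field.
  by repeat split; lra.
rewrite (prodpmf_marginal Hp i (fun a => G a u * (ln (w a) - 1))).
pose Ai := rsum (fun a => p a * f a a).
pose Bi := rsum (fun a => p a * (G a u * / w a)) * / L.
have B0 : 0 <= Bi.
  apply: Rmult_le_pos; last by apply/Rlt_le/Rinv_0_lt_compat.
  apply: rsum_ge0 => a; apply: Rmult_le_pos => //.
  by apply: Rmult_le_pos => //; have := wi a; lra.
(* For [j != i] independence replaces [G (C j) u] by its mean [q u], giving [Bi]. The diagonal term
   receives [Bi >= 0] on top of [Ai], so that there are exactly [L] copies. Then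
   [1 + G a u / (L * q u) = w a] makes the tangent correction cancel the [- 1] and only [ln (w a)]
   remains. *)
have H : rsum (fun j => rsum (fun C => prodpmf p C * f (C i) (C j))) <=
         rsum (fun j => (if j == i then Ai else 0) + Bi).
  apply: rsum_le => j; case: eqP => [->|/eqP ji].
    by rewrite (prodpmf_marginal Hp i (fun a => f a a)) -/Ai; lra.
  rewrite (prodpmf_marginal2 Hp); last by rewrite eq_sym.
  apply: Req_le; rewrite Rplus_0_l /Bi rsum_mulr; apply: rsum_ext => a.
  transitivity (p a * (G a u * / w a * / (L * q u) * q u)).
    set c := G a u * / w a * / (L * q u).
    rewrite -[X in _ = p a * (_ * X)]/(rsum (fun b => p b * G b u)) !rsum_mull.
    by apply: rsum_ext => b; rewrite /f /c; ring.
  by have := w1 a => ?; field; repeat split; lra.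
apply: (Rle_trans _ (rsum (fun a => p a * (G a u * (ln (w a) - 1))) + (Ai + L * Bi))).
  apply: Rplus_le_compat_l; apply: (Rle_trans _ _ _ H).
  by rewrite rsumD (rsum_delta i (fun=> Ai)) rsum_const; apply: Rle_refl.
apply: Req_le; rewrite /Bi /Ai.
set s := rsum (fun a => p a * (G a u * / w a)).
have -> : L * (s * / L) = s by field; lra.
rewrite -!rsumD; apply: rsum_ext => a.
have := w1 a; rewrite /f /w => wa; field; repeat split; try lra.
have := G0 a => ?; have : 0 < L * q u by apply: Rmult_lt_0_compat.
by lra.
Qed.

(** Each codeword gets its own tangent point: given [C i = a], the mixture divided by [q u] has mean
    [G a u / (L * q u) + (L - 1) / L], and [w u a] rounds the last fraction up to 1. *)
Lemma soft_covering (I : finType) (L := INR #|I|) :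
  (0 < #|I|)%N -> (forall u, 0 < q u) ->
  rsum (fun C => prodpmf p C *
    kl (fun u => / L * rsum (fun i : I => G (C i) u)) q)
  <= rsum (fun a => rsum (fun u => p a * (G a u * ln (1 + G a u / (L * q u))))) / ln 2.
Proof.
move=> I0 q0; case: (Hp) => p0 p1; have l2 := ln2_gt0.
have L0 : 0 < L by apply: lt_0_INR; apply/ltP.
have G0 a u : 0 <= G a u by exact: (HG a).1.
pose w u a := 1 + G a u / (L * q u).
have w1 u a : 1 <= w u a.
  have : 0 <= G a u / (L * q u); last by rewrite /w; lra.
  by apply: Rle_mult_inv_pos => //; apply: Rmult_lt_0_compat.
pose D (C : {ffun I -> A}) i u := G (C i) u *
  (ln (w u (C i)) + / L * rsum (fun j : I => G (C j) u) / q u / w u (C i) - 1).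
have Hkl (C : {ffun I -> A}) : kl (fun u => / L * rsum (fun i : I => G (C i) u)) q <=
   rsum (fun u => rsum (fun i => / L * D C i u)) / ln 2.
  rewrite /Rdiv rsum_mulr; apply: rsum_le => u.
  set s := rsum (fun i : I => G (C i) u).
  have s0 : 0 <= s by apply: rsum_ge0.
  case: Rlt_dec => Ps /=; last first.
    have sz : s = 0.
      case: (Rle_lt_dec s 0) => Hs; first lra.
      by case: Ps; apply: Rmult_lt_0_compat => //; exact: Rinv_0_lt_compat.
    suff -> : rsum (fun i => / L * D C i u) = 0 by lra.
    rewrite -[RHS](Rmult_0_r (INR #|I|)) -rsum_const; apply: rsum_ext => i.
    rewrite /D; suff -> : G (C i) u = 0 by lra.
    have : G (C i) u <= s by apply: (@rsum_ge_term _ (fun i => G (C i) u)).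
    by have := G0 (C i) u; lra.
  rewrite /log2 /Rdiv -Rmult_assoc; apply: Rmult_le_compat_r.
    by apply/Rlt_le/Rinv_0_lt_compat.
  rewrite -rsum_mull Rmult_assoc; apply: Rmult_le_compat_l.
    by apply/Rlt_le/Rinv_0_lt_compat.
  rewrite rsum_mulr; apply: rsum_le => i; apply: Rmult_le_compat_l => //.
  apply: ln_tangent; last by have := w1 u (C i); lra.
  by apply: Rmult_lt_0_compat => //; apply: Rinv_0_lt_compat.
apply: (Rle_trans _ (rsum (fun C => prodpmf p C *
    (rsum (fun u => rsum (fun i => / L * D C i u)) / ln 2)))).
  apply: rsum_le => C; apply: Rmult_le_compat_l => //.
  exact: (prodpmf_is_pmf _ Hp).1.
rewrite (@rsum_ext _ _ (fun C => (rsum (fun u => rsum (fun i =>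
   / L * (prodpmf p C * D C i u)))) * / ln 2)); last first.
  move=> C; rewrite /Rdiv -Rmult_assoc; congr (_ * _).
  rewrite rsum_mull; apply: rsum_ext => u; rewrite rsum_mull.
  by apply: rsum_ext => i; lra.
rewrite -rsum_mulr; apply: Rmult_le_compat_r.
  by apply/Rlt_le/Rinv_0_lt_compat.
rewrite rsum_exchange [X in _ <= X]rsum_exchange; apply: rsum_le => u.
rewrite rsum_exchange.
set r := (X in _ <= X).
(* The bound is split into equal shares, one per codeword, so that [soft_covering_term] applies to
   each. *)
have -> : r = rsum (fun _ : I => / L * r).
  by rewrite rsum_const -/L; field; lra.
apply: rsum_le => i; rewrite -rsum_mull; apply: Rmult_le_compat_l.
  by apply/Rlt_le/Rinv_0_lt_compat.
exact: soft_covering_term.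
Qed.

(** * One-shot random coding with a threshold decoder *)

Section Coding.
Variables (M K : nat) (m0 : 'I_M) (k0 : 'I_K) (t : R).
Hypothesis Ht : 0 < t.
Implicit Types (C : {ffun 'I_M * 'I_K -> A}).

(** The test that the information density exceeds [ln t], stated without a quotient so that it stays
    meaningful when [q u = 0]. *)
Definition passes (a : A) (u : U) : bool :=
  if Rlt_dec (t * q u) (G a u) then true else false.

(** Only codewords carrying the shared key [k] compete. [m0] is a default for when none passes;
    which passing message is picked does not matter, as the analysis charges every wrong message
    that passes. *)
Definition threshold_dec C (u : U) (k : 'I_K) : 'I_M :=
  odflt m0 [pick m | passes (C (m, k)) u].

Definition ind (c : bool) : R := if c then 1 else 0.

Lemma ind_ge0 c : 0 <= ind c.
Proof. by case: c => /=; lra. Qed.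

Definition error_prob C : R :=
  rsum (fun m => rsum (fun k => rsum (fun u =>
    if threshold_dec C u k == m then 0 else / INR M * / INR K * G (C (m, k)) u))).

(** Union bound: if [m] passes, the decoder returns a message that was picked because it passes, so
    a wrong answer is one of the summands. *)
Lemma threshold_dec_error C u k m :
  ind (threshold_dec C u k != m) <= ind (~~ passes (C (m, k)) u) +
    rsum (fun m' => if m' == m then 0 else ind (passes (C (m', k)) u)).
Proof.
set s := rsum _.
have term_ge0 m' : 0 <= if m' == m then 0 else ind (passes (C (m', k)) u).
  by case: ifP => _; [lra | exact: ind_ge0].
have s0 : 0 <= s by exact: rsum_ge0.
case: (boolP (passes (C (m, k)) u)) => Hm /=; last first.
  by case: (_ == _) => /=; lra.
rewrite /threshold_dec; case: pickP => [m' Hm'|/(_ m)]; last by rewrite Hm.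
rewrite /=; case: eqP => /= [_|/eqP mm']; first lra.
have := rsum_ge_term m' term_ge0.
by rewrite (negbTE mm') Hm' /= -/s; lra.
Qed.

(** By symmetry every pair [(m, k)] has the same bound: the true codeword fails, or one of the
    [M - 1] wrong codewords, each independent of the output, passes with probability at most
    [/ t]. *)
Lemma random_coding :
  rsum (fun C => prodpmf p C * error_prob C) <=
  rsum (fun a => rsum (fun u => p a * (G a u * ind (~~ passes a u)))) + (INR M - 1) * / t.
Proof.
case: (Hp) => p0 p1.
have G0 a u : 0 <= G a u by exact: (HG a).1.
have M0 : 0 < INR M by apply: lt_0_INR; apply/ltP; apply: leq_ltn_trans (ltn_ord m0).
have K0 : 0 < INR K by apply: lt_0_INR; apply/ltP; apply: leq_ltn_trans (ltn_ord k0).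
have MK0 : 0 < / INR M * / INR K by apply: Rmult_lt_0_compat; apply: Rinv_0_lt_compat.
set e1 := rsum (fun a => rsum _).
have Hmk m k : rsum (fun C => prodpmf p C * rsum (fun u =>
    G (C (m, k)) u * ind (threshold_dec C u k != m))) <= e1 + (INR M - 1) * / t.
  apply: (Rle_trans _ (rsum (fun C => prodpmf p C * rsum (fun u =>
      G (C (m, k)) u * ind (~~ passes (C (m, k)) u))) +
      rsum (fun m' => if m' == m then 0 else rsum (fun C => prodpmf p C *
        rsum (fun u => G (C (m, k)) u * ind (passes (C (m', k)) u)))))).
    rewrite (@rsum_ext _ (fun m' => if m' == m then 0 else _)
      (fun m' => rsum (fun C => prodpmf p C * rsum (fun u => G (C (m, k)) u *
         (if m' == m then 0 else ind (passes (C (m', k)) u)))))); last first.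
      move=> m'; case: eqP => // _; rewrite -[LHS](Rmult_0_r (INR #|{ffun 'I_M * 'I_K -> A}|)).
      rewrite -rsum_const; apply: rsum_ext => C.
      rewrite -[LHS](Rmult_0_r (prodpmf p C)); congr (_ * _).
      rewrite -[LHS](Rmult_0_r (INR #|U|)) -rsum_const; apply: rsum_ext => u; lra.
    rewrite rsum_exchange -rsumD; apply: rsum_le => C.
    rewrite -rsum_mull -Rmult_plus_distr_l; apply: Rmult_le_compat_l.
      exact: (prodpmf_is_pmf _ Hp).1.
    rewrite rsum_exchange -rsumD; apply: rsum_le => u.
    rewrite -rsum_mull -Rmult_plus_distr_l; apply: Rmult_le_compat_l => //.
    exact: threshold_dec_error.
  rewrite (prodpmf_marginal Hp (m, k) (fun a => rsum (fun u => G a u * ind (~~ passes a u)))).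
  apply: Rplus_le_compat.
    by apply: Req_le; apply: rsum_ext => a; rewrite rsum_mull.
  apply: (Rle_trans _ (rsum (fun m' => / t - if m' == m then / t else 0))); last first.
    rewrite rsumB rsum_const (rsum_delta m (fun=> / t)) card_ord.
    by apply: Req_le; lra.
  apply: rsum_le => m'; case: eqP => [_|/eqP mm']; first lra.
  rewrite (prodpmf_marginal2 Hp (fun a b => rsum (fun u => G a u * ind (passes b u)))); last first.
    by rewrite xpair_eqE eqxx andbT eq_sym.
  rewrite (@rsum_ext _ _ (fun a => rsum (fun b => rsum (fun u =>
     p a * G a u * (p b * ind (passes b u)))))); last first.
    move=> a; rewrite rsum_mull; apply: rsum_ext => b; rewrite rsum_mull rsum_mull.
    by apply: rsum_ext => u; lra.
  rewrite rsum_exchange Rminus_0_r -[X in _ <= X]Rmult_1_l -p1 rsum_mulr.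
  apply: rsum_le => b; rewrite rsum_exchange.
  rewrite -[X in _ <= p b * X]Rmult_1_l -(HG b).2 rsum_mulr rsum_mull.
  (* Change of measure: summing over the sent codeword leaves the output law [q u], and when [b]
     passes, [q u < G b u / t]. Summing [G b u] over [u] then gives 1. *)
  apply: rsum_le => u; rewrite -rsum_mulr -/(outpmf u).
  rewrite -Rmult_assoc (Rmult_comm (q u)) Rmult_assoc; apply: Rmult_le_compat_l => //.
  rewrite /passes; case: Rlt_dec => /= H; last first.
    have := Rmult_le_pos _ _ (G0 b u) (Rlt_le _ _ (Rinv_0_lt_compat _ Ht)); lra.
  rewrite Rmult_1_r; apply: (Rmult_le_reg_l t) => //.
  by rewrite (Rmult_comm (G b u)) -Rmult_assoc Rinv_r; lra.
set c := e1 + _.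
apply: (Rle_trans _ (rsum (fun m : 'I_M => rsum (fun k : 'I_K => / INR M * / INR K * c)))); last first.
  by rewrite !rsum_const !card_ord; apply: Req_le; field; lra.
rewrite (@rsum_ext _ _ (fun C => rsum (fun m => rsum (fun k => / INR M * / INR K *
  (prodpmf p C * rsum (fun u => G (C (m, k)) u * ind (threshold_dec C u k != m))))))); last first.
  move=> C; rewrite /error_prob rsum_mull; apply: rsum_ext => m; rewrite rsum_mull.
  apply: rsum_ext => k; rewrite !rsum_mull; apply: rsum_ext => u.
  by case: eqP => _ /=; lra.
rewrite rsum_exchange; apply: rsum_le => m; rewrite rsum_exchange; apply: rsum_le => k.
rewrite -rsum_mull; apply: Rmult_le_compat_l; first lra.
exact: Hmk.
Qed.

End Coding.
End OneShot.

(** * Exponential moments of variables with negative mean *)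

Lemma ln_le x y : 0 < x -> x <= y -> ln x <= ln y.
Proof. by move=> x0; case=> [/(ln_increasing _ _ x0)|->]; lra. Qed.

(** Multiply by [exp (- x) >= 1 - x]: the product [(1 - x) * (1 + x + 2 * x ^ 2)] is
    [1 + x ^ 2 * (1 - 2 * x)], hence at least 1. *)
Lemma exp_le_quadratic x : x <= 1 / 2 -> exp x <= 1 + x + 2 * x ^ 2.
Proof.
move=> hx; have H := exp_ineq1_le (- x).
have e0 := exp_pos (- x).
have -> : exp x = / exp (- x) by rewrite exp_Ropp Rinv_inv.
apply: (Rmult_le_reg_l (exp (- x))) => //; rewrite Rinv_r; last lra.
have H2 : 0 <= 1 + x + 2 * x ^ 2 by nra.
apply: (Rle_trans _ ((1 + - x) * (1 + x + 2 * x ^ 2))); last exact: Rmult_le_compat_r.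
have -> : (1 + - x) * (1 + x + 2 * x ^ 2) = 1 + x ^ 2 * (1 - 2 * x) by ring.
have : 0 <= x ^ 2 * (1 - 2 * x) by apply: Rmult_le_pos; [exact: pow2_ge_0 | lra].
lra.
Qed.

(** The moment [E exp (lam * h)] equals 1 at [lam = 0] and has derivative [E h < 0] there; the
    quadratic bound on [exp] makes this quantitative. *)
Lemma negative_mean_tilt (T : finType) (p h : T -> R) :
  is_pmf p -> rsum (fun t => p t * h t) < 0 ->
  exists lam, 0 < lam <= 1 /\ rsum (fun t => p t * exp (lam * h t)) < 1.
Proof.
move=> [p0 p1]; set mu := rsum _ => mu0.
pose m2 := rsum (fun t => p t * h t ^ 2).
pose D := 1 + rsum (fun t => Rabs (h t)).
have m20 : 0 <= m2.
  by apply: rsum_ge0 => t; apply: Rmult_le_pos => //; exact: pow2_ge_0.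
have D1 : 1 <= D.
  have := @rsum_ge0 _ (fun t => Rabs (h t)) (fun t => Rabs_pos _).
  by rewrite /D; lra.
have hD t : h t <= D.
  have := @rsum_ge_term _ (fun t => Rabs (h t)) t (fun t => Rabs_pos _).
  by have := Rle_abs (h t); rewrite /D; lra.
(* The first bound keeps [lam * h t <= 1 / 2], and [lam <= 1] since [D >= 1]. The second makes the
   quadratic term at most half of [- lam * mu]; the [1 +] guards against [m2 = 0]. *)
pose lam := Rmin (/ (2 * D)) (- mu / (4 * (1 + m2))).
have l1 : lam <= / (2 * D) by exact: Rmin_l.
have l2 : lam <= - mu / (4 * (1 + m2)) by exact: Rmin_r.
have l0 : 0 < lam.
  apply: Rmin_glb_lt; first by apply: Rinv_0_lt_compat; lra.
  by apply: Rdiv_lt_0_compat; lra.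
have lD : lam * D <= 1 / 2.
  have -> : 1 / 2 = / (2 * D) * D by field; lra.
  by apply: Rmult_le_compat_r; lra.
have lm : 4 * lam * m2 <= - mu.
  have := Rmult_le_compat_r (4 * (1 + m2)) _ _ ltac:(lra) l2.
  have -> : - mu / (4 * (1 + m2)) * (4 * (1 + m2)) = - mu by field; lra.
  by nra.
exists lam; split; first by nra.
apply: (Rle_lt_trans _ (1 + lam * mu + 2 * lam ^ 2 * m2)); last by nra.
rewrite -p1 /mu /m2 !rsum_mull -!rsumD; apply: rsum_le => t.
have := @exp_le_quadratic (lam * h t) => H.
have {}H : exp (lam * h t) <= 1 + lam * h t + 2 * (lam * h t) ^ 2.
  by apply: H; have := hD t; nra.
by have := Rmult_le_compat_l _ _ _ (p0 t) H; lra.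
Qed.

(** The right side is [x ^ lam / lam]. For [x <= 1] use [ln (1 + x) <= x <= x ^ lam]. For [x > 1]
    use [ln (1 + x) <= ln 2 + ln x <= (1 + lam * ln x) / lam] and [1 + y <= exp y]. *)
Lemma ln1p_le_power x lam : 0 < x -> 0 < lam <= 1 ->
  ln (1 + x) <= / lam * exp (lam * ln x).
Proof.
move=> x0 [l0 l1].
have il : 1 <= / lam by rewrite -Rinv_1; apply: Rinv_le_contravar; lra.
have e0 := exp_pos (lam * ln x).
case: (Rle_lt_dec x 1) => hx.
  have lx : ln x <= 0 by have := ln_le_sub1 x0; lra.
  have H : x <= exp (lam * ln x).
    have {1}-> : x = exp (ln x) by rewrite exp_ln.
    have : ln x <= lam * ln x by nra.
    by case => [/exp_increasing|<-]; lra.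
  have := @ln_le_sub1 (1 + x) ltac:(lra); nra.
have l2 : ln 2 <= 1 by have := @ln_le_sub1 2 ltac:(lra); lra.
have : ln (1 + x) <= ln (2 * x).
  by apply/Rlt_le/ln_increasing; lra.
rewrite ln_mult //; last lra.
have := exp_ineq1_le (lam * ln x) => H.
have : / lam * (1 + lam * ln x) <= / lam * exp (lam * ln x).
  by apply: Rmult_le_compat_l; lra.
have -> : / lam * (1 + lam * ln x) = / lam + ln x by field; lra.
lra.
Qed.

(** * Memoryless extensions of a channel with i.i.d. inputs *)

Section Memoryless.
Variables (A U : finType) (p : A -> R) (G : A -> U -> R).
Hypotheses (Hp : is_pmf p) (HG : forall a, is_pmf (G a)).
Local Notation q := (outpmf p G).
Variable n : nat.
Implicit Types (a : {ffun 'I_n -> A}) (u : {ffun 'I_n -> U}).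

Definition extension a u : R := rprod (fun i => G (a i) (u i)).

Lemma extension_is_pmf a : is_pmf (extension a).
Proof.
split=> [u|]; first by apply: rprod_ge0 => i; exact: (HG _).1.
transitivity (rprod (fun i => rsum (G (a i)))); first by rewrite rprod_rsum.
rewrite -[RHS](pow1 n) -(rprod_const n); by apply: rprod_ext => i; exact: (HG _).2.
Qed.

Lemma outpmf_extension u :
  outpmf (prodpmf p) extension u = rprod (fun i => q (u i)).
Proof.
rewrite /outpmf rprod_rsum; apply: rsum_ext => a.
by rewrite rprodM.
Qed.

(** Independence across letters, by distributivity: this is what turns blocklength-[n] bounds into
    powers of single-letter moments. *)
Lemma expectation_rprod (e : A -> U -> R) :
  rsum (fun a => rsum (fun u =>
    prodpmf p a * (extension a u * rprod (fun i => e (a i) (u i))))) =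
  rsum (fun x => rsum (fun y => p x * (G x y * e x y))) ^ n.
Proof.
rewrite -rprod_const rprod_rsum; apply: rsum_ext => a.
rewrite rprod_rsum; apply: rsum_ext => u.
by rewrite !rprodM.
Qed.

(** On the support of the joint law all letter ratios are positive, so their logarithms are genuine;
    off it, the totalized values of [ln] and division only occur with weight 0. *)
Lemma extension_pos a u : 0 < prodpmf p a * extension a u ->
  forall i, [/\ 0 < p (a i), 0 < G (a i) (u i) & 0 < q (u i)].
Proof.
move=> H i; rewrite /prodpmf /extension -rprodM in H.
have H0 : p (a i) * G (a i) (u i) <> 0.
  apply: (rprod_neq0 (f := fun i => p (a i) * G (a i) (u i))).
  by apply: Rgt_not_eq; exact: H.
have pa : 0 < p (a i) by case: (Hp.1 (a i)) => // E; case: H0; rewrite -E; ring.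
have ga : 0 < G (a i) (u i).
  by case: ((HG (a i)).1 (u i)) => // E; case: H0; rewrite -E; ring.
split => //; apply: (Rlt_le_trans _ (p (a i) * G (a i) (u i))).
  exact: Rmult_lt_0_compat.
apply: (@rsum_ge_term _ (fun x => p x * G x (u i))) => x.
by apply: Rmult_le_pos; [exact: Hp.1 | exact: (HG x).1].
Qed.

(** The offset [c] is pulled out of each letter so that the remaining exponent is a sum whose mean
    has a known sign. *)
Lemma extension_ratio a u c : 0 < prodpmf p a * extension a u ->
  extension a u = exp c ^ n * rprod (fun i => q (u i)) *
    exp (rsum (fun i => ln (G (a i) (u i) / q (u i)) - c)).
Proof.
move=> H; rewrite -rprod_exp -(rprod_const n) -!rprodM; apply: rprod_ext => i.
have [_ g0 q0] := extension_pos H i.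
rewrite /Rminus exp_plus exp_Ropp exp_ln; last exact: Rdiv_lt_0_compat.
have := exp_pos c => ec; field; lra.
Qed.

End Memoryless.

(** * Exponential decay of the covering and decoding bounds *)

Section Exponents.
Variables (A U : finType) (p : A -> R) (G : A -> U -> R).
Hypotheses (Hp : is_pmf p) (HG : forall a, is_pmf (G a)).
Local Notation q := (outpmf p G).

(** Mutual information in nats. Terms of probability 0 vanish through the weight [p a * G a u]
    instead of a case test. *)
Definition mean_density : R :=
  rsum (fun a => rsum (fun u => p a * (G a u * ln (G a u / q u)))).

Lemma mutinf_mean_density :
  mutinf (fun a u => p a * G a u) = mean_density / ln 2.
Proof.
rewrite /Rdiv /mutinf /mean_density rsum_mulr; apply: rsum_ext => a.
rewrite rsum_mulr; apply: rsum_ext => u; rewrite -/(outpmf p G u).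
rewrite -rsum_mull (HG a).2 Rmult_1_r.
case: Rlt_dec => /= H.
  have pa : 0 < p a by case: (Hp.1 a) => // E; move: H; rewrite -E; lra.
  have qu : 0 < q u.
    apply: (Rlt_le_trans _ _ _ H); apply: (@rsum_ge_term _ (fun x => p x * G x u)) => x.
    by apply: Rmult_le_pos; [exact: Hp.1 | exact: (HG x).1].
  have -> : p a * G a u / (p a * q u) = G a u / q u by field; lra.
  by rewrite /log2 /Rdiv; ring.
have : p a * G a u = 0.
  have : 0 <= p a * G a u by apply: Rmult_le_pos; [exact: Hp.1 | exact: (HG a).1].
  by lra.
by rewrite -Rmult_assoc => ->; lra.
Qed.

Lemma joint_is_pmf : is_pmf (fun x : A * U => p x.1 * G x.1 x.2).
Proof.
split=> [x|]; first by apply: Rmult_le_pos; [exact: Hp.1 | exact: (HG _).1].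
rewrite rsum_pair -[RHS]Hp.2; apply: rsum_ext => a /=.
by rewrite -rsum_mull (HG a).2; lra.
Qed.

(** [sgn = 1] serves the upper tail of the information density, for covering, and [sgn = -1] the
    lower tail, for decoding. *)
Lemma density_tilt (sgn c : R) : sgn * (mean_density - c) < 0 ->
  exists lam, 0 < lam <= 1 /\
    rsum (fun a => rsum (fun u => p a * (G a u *
      exp (lam * (sgn * (ln (G a u / q u) - c)))))) < 1.
Proof.
move=> H.
pose h (x : A * U) := sgn * (ln (G x.1 x.2 / q x.2) - c).
have [|lam [Hl Ht]] := @negative_mean_tilt _ _ h joint_is_pmf.
  suff -> : rsum (fun x : A * U => p x.1 * G x.1 x.2 * h x) = sgn * (mean_density - c) by [].
  rewrite -[c in RHS]Rmult_1_r -joint_is_pmf.2 /mean_density rsum_mull rsum_pair rsum_pair.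
  rewrite -rsumB rsum_mull; apply: rsum_ext => a.
  rewrite -rsumB rsum_mull; apply: rsum_ext => u; rewrite /h /=; ring.
exists lam; split => //; apply: Rle_lt_trans Ht; apply: Req_le.
by rewrite rsum_pair; apply: rsum_ext => a; apply: rsum_ext => u; rewrite /h /=; ring.
Qed.

Lemma tilt_ge0 (e : A -> U -> R) :
  0 <= rsum (fun a => rsum (fun u => p a * (G a u * exp (e a u)))).
Proof.
apply: rsum_ge0 => a; apply: rsum_ge0 => u; apply: Rmult_le_pos; first exact: Hp.1.
by apply: Rmult_le_pos; [exact: (HG a).1 | exact/Rlt_le/exp_pos].
Qed.

Lemma soft_covering_exponent (c : R) : (forall u, 0 < q u) -> mean_density < c ->
  exists lam th, 0 < lam /\ 0 <= th < 1 /\ forall n (L : R), exp c ^ n <= L ->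
    rsum (fun a : {ffun 'I_n -> A} => rsum (fun u : {ffun 'I_n -> U} =>
      prodpmf p a * (extension G a u *
        ln (1 + extension G a u / (L * outpmf (prodpmf p) (extension G (n:=n)) u)))))
    <= / lam * th ^ n.
Proof.
move=> q0 Hc; have [|lam [Hl Hth]] := @density_tilt 1 c; first lra.
exists lam; eexists; split; first lra.
split; first by split; [|exact: Hth]; exact: (tilt_ge0 (fun a u => lam * (1 * (ln (G a u / q u) - c)))).
move=> n L HL.
rewrite -expectation_rprod rsum_mull; apply: rsum_le => a.
rewrite rsum_mull; apply: rsum_le => u.
rewrite outpmf_extension; set Q := rprod (fun i => q (u i)).
have Q0 : 0 < Q by exact: rprod_gt0.
have g0 : 0 <= extension G a u := (extension_is_pmf HG a).1 u.
have p0 : 0 <= prodpmf p a := (prodpmf_is_pmf 'I_n Hp).1 a.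
have e0 : 0 < exp c ^ n by apply: pow_lt; exact: exp_pos.
set X := ln (1 + _); set Y := rprod (fun i => exp _).
have -> : prodpmf p a * (extension G a u * X) = prodpmf p a * extension G a u * X by ring.
have -> : / lam * (prodpmf p a * (extension G a u * Y)) =
  prodpmf p a * extension G a u * (/ lam * Y) by ring.
case: (Rle_lt_dec (prodpmf p a * extension G a u) 0) => [Hle|Hpos].
  have E : prodpmf p a * extension G a u = 0 by have := Rmult_le_pos _ _ p0 g0; lra.
  rewrite E !Rmult_0_l; exact: Rle_refl.
apply: Rmult_le_compat_l; first lra.
rewrite {}/X {}/Y.
set s := rsum (fun i => ln (G (a i) (u i) / q (u i)) - c).
have es := exp_pos s.
(* The size condition on [L] absorbs the offset [exp c ^ n], leaving the centred sum [s], to which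
   the power bound on [ln (1 + exp s)] applies. *)
have R1 : extension G a u / (L * Q) <= exp s.
  rewrite (extension_ratio Hp HG c Hpos) -/Q -/s.
  have -> : exp c ^ n * Q * exp s / (L * Q) = exp c ^ n / L * exp s by field; lra.
  rewrite -[X in _ <= X]Rmult_1_l; apply: Rmult_le_compat_r; first lra.
  by apply: (Rmult_le_reg_r L); [lra | rewrite /Rdiv Rmult_assoc Rinv_l; lra].
apply: (Rle_trans _ (ln (1 + exp s))).
  apply: ln_le; last by lra.
  have : 0 <= extension G a u / (L * Q).
    by apply: Rle_mult_inv_pos => //; apply: Rmult_lt_0_compat; lra.
  lra.
apply: (Rle_trans _ _ _ (ln1p_le_power es Hl)).
rewrite ln_exp; apply: Rmult_le_compat_l.
  by apply/Rlt_le/Rinv_0_lt_compat; lra.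
apply: Req_le; rewrite (rprod_exp (fun i => lam * (1 * (ln (G (a i) (u i) / q (u i)) - c)))).
by congr exp; rewrite /s rsum_mull; apply: rsum_ext => i; ring.
Qed.

(** Chernoff bound: failing the test forces the centred sum [s] to be nonpositive, so the indicator
    is at most [exp (- lam * s)], whose mean is the power of a tilted moment. *)
Lemma threshold_exponent (c : R) : c < mean_density ->
  exists th, 0 <= th < 1 /\ forall n,
    rsum (fun a : {ffun 'I_n -> A} => rsum (fun u : {ffun 'I_n -> U} =>
      prodpmf p a * (extension G a u *
        ind (~~ passes (prodpmf p) (extension G (n:=n)) (exp c ^ n) a u)))) <= th ^ n.
Proof.
move=> Hc; have [|lam [Hl Hth]] := @density_tilt (-1) c; first lra.
eexists; split; first by split; [|exact: Hth]; exact: (tilt_ge0 (fun a u => lam * (-1 * (ln (G a u / q u) - c)))).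
move=> n; rewrite -expectation_rprod; apply: rsum_le => a; apply: rsum_le => u.
have g0 : 0 <= extension G a u := (extension_is_pmf HG a).1 u.
have p0 : 0 <= prodpmf p a := (prodpmf_is_pmf 'I_n Hp).1 a.
have e0 : 0 < exp c ^ n by apply: pow_lt; exact: exp_pos.
case: (Rle_lt_dec (prodpmf p a * extension G a u) 0) => [Hle|Hpos].
  have E : prodpmf p a * extension G a u = 0 by have := Rmult_le_pos _ _ p0 g0; lra.
  by rewrite -!Rmult_assoc E; lra.
rewrite -!Rmult_assoc; apply: Rmult_le_compat_l; first lra.
rewrite (rprod_exp (fun i => lam * (-1 * (ln (G (a i) (u i) / q (u i)) - c)))).
rewrite /passes outpmf_extension; set Q := rprod (fun i => q (u i)).
case: Rlt_dec => /= H; first exact/Rlt_le/exp_pos.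
have Q0 : 0 < Q by apply: rprod_gt0 => i; have [] := extension_pos Hp HG Hpos i.
set s := rsum (fun i => ln (G (a i) (u i) / q (u i)) - c).
have s0 : s <= 0.
  case: (Rle_lt_dec s 0) => // s0; case: H.
  rewrite (extension_ratio Hp HG c Hpos) -/Q -/s -[X in X < _]Rmult_1_r.
  apply: Rmult_lt_compat_l; first exact: Rmult_lt_0_compat.
  by rewrite -exp_0; exact: exp_increasing.
have -> : rsum (fun i => lam * (-1 * (ln (G (a i) (u i) / q (u i)) - c))) = - lam * s.
  by rewrite /s rsum_mull; apply: rsum_ext => i; ring.
have : 0 <= - lam * s by nra.
by have := exp_ineq1_le (- lam * s); lra.
Qed.

End Exponents.

(** * Codebook sizes and geometric convergence *)

(** [up (- t)] lies in [(- t, 1 - t]], which places the size in [[t, t + 1)]. The lower bound feeds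
    the covering condition; the upper one is stated for the size minus 1, the number of wrong
    messages. *)
Lemma nsize_bounds n r :
  Rpower 2 (INR n * r) <= INR (nsize n r) /\
  INR (nsize n r) - 1 <= Rpower 2 (INR n * r).
Proof.
rewrite /nsize; set t := Rpower 2 _.
have t0 : 0 < t by exact: exp_pos.
have [u1 u2] := archimed (- t).
have z0 : (0 <= 1 - up (- t))%Z.
  by apply: le_IZR; rewrite minus_IZR; lra.
by rewrite INR_IZR_INZ Z2Nat.id // minus_IZR; lra.
Qed.

Lemma Rpower2_pow n r : Rpower 2 (INR n * r) = exp (r * ln 2) ^ n.
Proof.
rewrite -Rpower_pow; last exact: exp_pos.
by rewrite /Rpower ln_exp; congr exp; ring.
Qed.

Lemma cv0_geometric (u : nat -> R) c th :
  0 <= th < 1 -> (forall n, 0 <= u n <= c * th ^ n) -> Un_cv u 0.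
Proof.
move=> Hth Hu eps e0.
have c0 : 0 <= c by have := Hu 0%N; rewrite /=; lra.
(* Division by [c + 1] because [c] may be 0. *)
have [N HN] := pow_lt_1_zero th ltac:(rewrite Rabs_right; lra) (eps / (c + 1))
  ltac:(apply: Rdiv_lt_0_compat; lra).
exists N => n Hn; have {}HN := HN n Hn.
have t0 : 0 <= th ^ n by apply: pow_le; lra.
rewrite /R_dist Rminus_0_r Rabs_right; last by have := Hu n; lra.
rewrite Rabs_right in HN; last lra.
have : (c + 1) * th ^ n < eps.
  have -> : eps = (c + 1) * (eps / (c + 1)) by field; lra.
  by apply: Rmult_lt_compat_l; lra.
by have := Hu n; lra.
Qed.

(** * Codes built from Shannon strategies *)

Section Codes.
Variables (X S Y Z : finType) (PS : S -> R) (W : S -> X -> Y -> Z -> R) (b : X -> R).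
Hypotheses (HPS : is_pmf PS) (HW : is_channel W) (Hb : forall x, 0 <= b x).
Variables (V : finType) (PV : V -> R) (xf : V -> S -> X).
Hypothesis HPV : is_pmf PV.

(** Averaging over the state turns a strategy letter [v] into the input of an ordinary memoryless
    channel; [chanZ] is the same for the warden. *)
Definition chanY (v : V) (y : Y) : R := rsum (fun s => PS s * rsum (fun z => W s (xf v s) y z)).
Definition chanZ (v : V) (z : Z) : R := rsum (fun s => PS s * rsum (fun y => W s (xf v s) y z)).

Lemma chanY_is_pmf v : is_pmf (chanY v).
Proof.
split=> [y|].
  apply: rsum_ge0 => s; apply: Rmult_le_pos; first exact: HPS.1.
  by apply: rsum_ge0 => z; exact: (HW s _).1.
rewrite /chanY rsum_exchange -[RHS]HPS.2; apply: rsum_ext => s.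
by rewrite -rsum_mull -(rsum_pair (fun yz => W s (xf v s) yz.1 yz.2)) (HW s _).2 Rmult_1_r.
Qed.

Lemma chanZ_is_pmf v : is_pmf (chanZ v).
Proof.
split=> [z|].
  apply: rsum_ge0 => s; apply: Rmult_le_pos; first exact: HPS.1.
  by apply: rsum_ge0 => y; exact: (HW s _).1.
rewrite /chanZ rsum_exchange -[RHS]HPS.2; apply: rsum_ext => s.
rewrite -rsum_mull rsum_exchange.
by rewrite -(rsum_pair (fun yz => W s (xf v s) yz.1 yz.2)) (HW s _).2 Rmult_1_r.
Qed.

Lemma PVY_chanY : PVY PS W PV xf = fun v y => PV v * chanY v y.
Proof.
apply: functional_extensionality => v; apply: functional_extensionality => y.
by rewrite /PVY /chanY rsum_mull; apply: rsum_ext => s; ring.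
Qed.

Lemma PVZ_chanZ : PVZ PS W PV xf = fun v z => PV v * chanZ v z.
Proof.
apply: functional_extensionality => v; apply: functional_extensionality => z.
by rewrite /PVZ /chanZ rsum_mull; apply: rsum_ext => s; ring.
Qed.

Lemma PZ_outpmf z : PZ PS W PV xf z = outpmf PV chanZ z.
Proof. by rewrite /PZ PVZ_chanZ. Qed.

Variables (n M K : nat).
Hypotheses (M0 : (0 < M)%N) (K0 : (0 < K)%N).

(** The strategy encoder is deterministic, so its private randomness lives on a one-point type. *)
Definition trivial_randomness (w : unit) : R := 1.

Lemma trivial_randomness_is_pmf : is_pmf trivial_randomness.
Proof.
split=> [w|]; first by rewrite /trivial_randomness; lra.
by rewrite rsum_const card_unit /=; lra.
Qed.

Section FixedCodebook.
Variables (C : {ffun 'I_M * 'I_K -> {ffun 'I_n -> V}}) (d : {ffun 'I_n -> Y} -> 'I_K -> 'I_M).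

(* Shannon strategies: the symbol [C (m, k) i] selects the map from the current
   state to the channel input. *)
Definition strategy_enc (i : 'I_n) (m : 'I_M) (k : 'I_K) (s : {ffun 'I_n -> S}) (w : unit) : X :=
  xf (C (m, k) i) (s i).

Lemma strategy_enc_causal (i : 'I_n) (m : 'I_M) (k : 'I_K) (w : unit) (s s' : {ffun 'I_n -> S}) :
  (forall j : 'I_n, (j <= i)%N -> s j = s' j) ->
  strategy_enc i m k s w = strategy_enc i m k s' w.
Proof. by move=> H; rewrite /strategy_enc H. Qed.

Definition strategy_code : code X S Y n M K :=
  Code trivial_randomness_is_pmf strategy_enc_causal d.

Lemma rsum_rprod2 (P Q : finType) (f : 'I_n -> P -> Q -> R) :
  rsum (fun s : {ffun 'I_n -> P} => rsum (fun t : {ffun 'I_n -> Q} =>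
    rprod (fun i => f i (s i) (t i)))) =
  rprod (fun i => rsum (fun x => rsum (fun y => f i x y))).
Proof. by rewrite rprod_rsum; apply: rsum_ext => s; rewrite rprod_rsum. Qed.

(** The encoder acts letter by letter, so the sums over states and receiver outputs factor. Message
    and key together index the mixture, so both count as covering randomness. *)
Lemma Phat_strategy_code z :
  Phat PS W strategy_code z =
  / INR #|{: 'I_M * 'I_K}| * rsum (fun l => extension chanZ (C l) z).
Proof.
have HM : INR M <> 0 by apply: not_0_INR; case: (M) M0.
have HK : INR K <> 0 by apply: not_0_INR; case: (K) K0.
rewrite card_prod !card_ord mult_INR Rinv_mult rsum_mull rsum_pair.
apply: rsum_ext => m; apply: rsum_ext => k.
etransitivity; first exact: rsum_unit.
rewrite /weight /= /trivial_randomness /strategy_enc.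
transitivity (/ INR M * / INR K * rsum (fun s : {ffun 'I_n -> S} => rsum (fun y : {ffun 'I_n -> Y} =>
    rprod (fun i => PS (s i) * W (s i) (xf (C (m, k) i) (s i)) (y i) (z i))))).
  rewrite rsum_mull; apply: rsum_ext => s; rewrite rsum_mull.
  by apply: rsum_ext => y; rewrite Rmult_1_r.
rewrite (rsum_rprod2 (fun i s y => PS s * W s (xf (C (m, k) i) s) y (z i))).
congr (_ * _); apply: rprod_ext => i; apply: rsum_ext => s.
by rewrite rsum_mull.
Qed.

Lemma Pe_strategy_code :
  Pe PS W strategy_code =
  rsum (fun m => rsum (fun k => rsum (fun y =>
    if d y k == m then 0 else / INR M * / INR K * extension chanY (C (m, k)) y))).
Proof.
apply: rsum_ext => m; apply: rsum_ext => k.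
etransitivity; first exact: rsum_unit.
rewrite rsum_exchange; apply: rsum_ext => y /=.
case: eqP => _.
  rewrite -[RHS](Rmult_0_r (INR #|{ffun 'I_n -> S}|)) -rsum_const; apply: rsum_ext => s.
  by rewrite rsum_const Rmult_0_r.
rewrite /weight /= /trivial_randomness /strategy_enc.
transitivity (/ INR M * / INR K * rsum (fun s : {ffun 'I_n -> S} => rsum (fun z : {ffun 'I_n -> Z} =>
    rprod (fun i => PS (s i) * W (s i) (xf (C (m, k) i) (s i)) (y i) (z i))))).
  rewrite rsum_mull; apply: rsum_ext => s; rewrite rsum_mull.
  by apply: rsum_ext => z; rewrite Rmult_1_r.
rewrite (rsum_rprod2 (fun i s z => PS s * W s (xf (C (m, k) i) s) (y i) z)).
congr (_ * _); apply: rprod_ext => i; apply: rsum_ext => s.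
by rewrite rsum_mull.
Qed.

Definition symbol_cost (v : V) : R := rsum (fun s => PS s * b (xf v s)).

Lemma Ebn_strategy_code :
  Ebn PS strategy_code b =
  rsum (fun m => rsum (fun k => / INR M * / INR K *
    (/ INR n * rsum (fun i => symbol_cost (C (m, k) i))))).
Proof.
apply: rsum_ext => m; apply: rsum_ext => k.
etransitivity; first exact: rsum_unit.
rewrite /= /trivial_randomness /strategy_enc.
transitivity (/ INR M * / INR K * (/ INR n * rsum (fun i => rsum (fun s : {ffun 'I_n -> S} =>
    prodpmf PS s * b (xf (C (m, k) i) (s i)))))).
  rewrite rsum_exchange !rsum_mull; apply: rsum_ext => s.
  have E (x p i y : R) : x * 1 * p * (i * y) = x * (i * (p * y)) by ring.
  by rewrite -rsum_mull; exact: E.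
congr (_ * (_ * _)); apply: rsum_ext => i.
exact: (prodpmf_marginal HPS i (fun s => b (xf (C (m, k) i) s))).
Qed.

Lemma Phat_is_pmf : is_pmf (Phat PS W strategy_code).
Proof.
have L0 : 0 < INR #|{: 'I_M * 'I_K}|.
  by apply: lt_0_INR; apply/ltP; rewrite card_prod !card_ord muln_gt0 M0 K0.
split=> [z|].
  rewrite Phat_strategy_code; apply: Rmult_le_pos; first exact/Rlt_le/Rinv_0_lt_compat.
  by apply: rsum_ge0 => l; exact: (extension_is_pmf chanZ_is_pmf _).1.
rewrite (rsum_ext Phat_strategy_code) -rsum_mull rsum_exchange.
rewrite (@rsum_ext _ _ (fun=> 1)); last first.
  by move=> l; exact: (extension_is_pmf chanZ_is_pmf _).2.
by rewrite rsum_const Rmult_1_r; exact: (Rinv_l _ (Rgt_not_eq _ _ L0)).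
Qed.

Lemma Pe_ge0 : 0 <= Pe PS W strategy_code.
Proof.
rewrite Pe_strategy_code; apply: rsum_ge0 => m; apply: rsum_ge0 => k; apply: rsum_ge0 => y.
case: ifP => _; first lra.
apply: Rmult_le_pos; last exact: (extension_is_pmf chanY_is_pmf _).1.
by apply/Rlt_le/Rmult_lt_0_compat; apply: Rinv_0_lt_compat; apply: lt_0_INR; apply/ltP.
Qed.

Lemma symbol_cost_ge0 v : 0 <= symbol_cost v.
Proof. by apply: rsum_ge0 => s; apply: Rmult_le_pos => //; exact: HPS.1. Qed.

Lemma Ebn_ge0 : 0 <= Ebn PS strategy_code b.
Proof.
rewrite Ebn_strategy_code; apply: rsum_ge0 => m; apply: rsum_ge0 => k.
apply: Rmult_le_pos.
  by apply/Rlt_le/Rmult_lt_0_compat; apply: Rinv_0_lt_compat; apply: lt_0_INR; apply/ltP.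
have s0 : 0 <= rsum (fun i => symbol_cost (C (m, k) i)).
  by apply: rsum_ge0 => i; exact: symbol_cost_ge0.
apply: Rmult_le_pos => //; case: (posnP n) => [->|n0]; first by rewrite Rinv_0; lra.
by apply/Rlt_le/Rinv_0_lt_compat; apply: lt_0_INR; apply/ltP.
Qed.

End FixedCodebook.

Lemma Eb_symbol_cost : Eb PS b PV xf = rsum (fun v => PV v * symbol_cost v).
Proof.
apply: rsum_ext => v; rewrite rsum_mull; apply: rsum_ext => s; ring.
Qed.

(** Every codeword letter has law [PV], so the mean is [Eb] itself for [n > 0]. The inequality
    accommodates [n = 0], where [/ INR n] is 0. The decoder may depend on the codebook. *)
Lemma mean_Ebn (d : {ffun 'I_M * 'I_K -> {ffun 'I_n -> V}} -> {ffun 'I_n -> Y} -> 'I_K -> 'I_M) :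
  rsum (fun C => prodpmf (prodpmf PV) C * Ebn PS (strategy_code C (d C)) b) <= Eb PS b PV xf.
Proof.
have M1 : 0 < INR M by apply: lt_0_INR; apply/ltP.
have K1 : 0 < INR K by apply: lt_0_INR; apply/ltP.
set mu := Eb _ _ _ _.
have mu0 : 0 <= mu.
  rewrite /mu Eb_symbol_cost; apply: rsum_ge0 => v.
  by apply: Rmult_le_pos; [exact: HPV.1 | exact: symbol_cost_ge0].
have Hmk m k : rsum (fun C : {ffun 'I_M * 'I_K -> {ffun 'I_n -> V}} =>
    prodpmf (prodpmf PV) C * rsum (fun i => symbol_cost (C (m, k) i))) = INR n * mu.
  rewrite (prodpmf_marginal (prodpmf_is_pmf _ HPV) (m, k)
    (fun v : {ffun 'I_n -> V} => rsum (fun i => symbol_cost (v i)))).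
  rewrite -[n in RHS]card_ord -rsum_const.
  rewrite (@rsum_ext _ _ (fun v => rsum (fun i => prodpmf PV v * symbol_cost (v i)))); last first.
    by move=> v; rewrite rsum_mull.
  rewrite rsum_exchange; apply: rsum_ext => i.
  by rewrite (prodpmf_marginal HPV i symbol_cost) /mu Eb_symbol_cost.
rewrite (@rsum_ext _ _ (fun C => rsum (fun m => rsum (fun k => / INR M * / INR K * / INR n *
    (prodpmf (prodpmf PV) C * rsum (fun i => symbol_cost (C (m, k) i))))))); last first.
  have E (x y i w : R) : w * (x * (i * y)) = x * i * (w * y) by ring.
  move=> C; rewrite Ebn_strategy_code rsum_mull; apply: rsum_ext => m.
  by rewrite rsum_mull; apply: rsum_ext => k; exact: E.
rewrite rsum_exchange.
rewrite (@rsum_ext _ _ (fun=> INR K * (/ INR M * / INR K * / INR n * (INR n * mu)))).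
  rewrite rsum_const card_ord; case: (posnP n) => [->|n0].
    by rewrite Rinv_0 Rmult_0_r Rmult_0_l !Rmult_0_r.
  have n1 : 0 < INR n by apply: lt_0_INR; apply/ltP.
  by apply: Req_le; field; lra.
move=> m; rewrite rsum_exchange.
transitivity (rsum (fun _ : 'I_K => / INR M * / INR K * / INR n * (INR n * mu))).
  by apply: rsum_ext => k; rewrite -rsum_mull Hmk.
by rewrite rsum_const card_ord.
Qed.

End Codes.

(** * Choice of the rate and of one good codebook per blocklength *)

Theorem theorem2 (X S Y Z : finType) (PS : S -> R) (W : S -> X -> Y -> Z -> R)
  (x0 : X) (b : X -> R)
  (HPS : is_pmf PS) (HW : is_channel W)
  (Hsupp : forall z : Z, 0 < Q0 PS W x0 z)
  (Hb : forall x : X, 0 <= b x)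
  (RK B : R) (HRK : 0 <= RK) (HB : 0 <= B)
  (V : finType)
  (HV : (#|V| <= minn (#|X| + #|Y| + #|Z| - 1) ((#|X| - 1) * #|S| + 2))%N)
  (PV : V -> R) (xf : V -> S -> X) :
  is_pmf PV ->
  (forall z : Z, PZ PS W PV xf z = Q0 PS W x0 z) ->
  Eb PS b PV xf <= B ->
  mutinf (PVZ PS W PV xf) - mutinf (PVY PS W PV xf) < RK ->
  sup_ge (fun r => achievable_causal PS W x0 b B RK r) (mutinf (PVY PS W PV xf)).
Proof.
move=> HPV HZ Hcost Hkey eps eps0.
have l2 := ln2_gt0.
have HY := chanY_is_pmf HPS HW xf; have HZc := chanZ_is_pmf HPS HW xf.
rewrite PVY_chanY PVZ_chanZ in Hkey *.
rewrite !mutinf_mean_density // in Hkey *.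
set IY := mean_density PV (chanY PS W xf) in Hkey *.
set IZ := mean_density PV (chanZ PS W xf) in Hkey *.
(* Half of the smaller of the tolerance and the slack in the key constraint: the rate [r] below
   stays within [eps] of [I(V;Y)], while [r + RK] still exceeds [I(V;Z)]. *)
pose del := Rmin eps (RK - (IZ / ln 2 - IY / ln 2)) / 2.
have d0 : 0 < del by apply: Rdiv_lt_0_compat; [apply: Rmin_glb_lt; lra | lra].
have d1 : 2 * del <= eps by have := Rmin_l eps (RK - (IZ / ln 2 - IY / ln 2)); rewrite /del; lra.
have d2 : 2 * del <= RK - (IZ / ln 2 - IY / ln 2).
  by have := Rmin_r eps (RK - (IZ / ln 2 - IY / ln 2)); rewrite /del; lra.
pose r := IY / ln 2 - del.
exists r; split; last by rewrite /r; lra.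
(* In nats: the decoding threshold [gam] lies midway between the rate [r * ln 2] and [IY], and [c]
   is the total rate of message and key. *)
pose gam := IY - del / 2 * ln 2.
pose c := (r + RK) * ln 2.
have IYe : IY / ln 2 * ln 2 = IY by field; lra.
have IZe : IZ / ln 2 * ln 2 = IZ by field; lra.
have hc : IZ < c by rewrite /c /r -IZe; apply: Rmult_lt_compat_r; lra.
have dl : 0 < del * ln 2 by apply: Rmult_lt_0_compat.
have hg : gam < IY by rewrite /gam; lra.
have hr : r * ln 2 - gam < 0 by rewrite /r /gam Rmult_minus_distr_r IYe; lra.
have q0 z : 0 < outpmf PV (chanZ PS W xf) z by rewrite -PZ_outpmf HZ.
have [lam [th1 [lam0 [Hth1 Hsoft]]]] := soft_covering_exponent HPV HZc q0 hc.
have [th2 [Hth2 Hthr]] := threshold_exponent HPV HY hg.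
(* Decay rate of the union-bound term [(M - 1) / t]. *)
pose th3 := exp (r * ln 2 - gam).
have Hth3 : 0 < th3 < 1.
  by split; [exact: exp_pos | rewrite -exp_0; exact: exp_increasing].
pose th := Rmax th3 (Rmax th1 th2).
have Hth : 0 < th < 1.
  split; first by have := Rmax_l th3 (Rmax th1 th2); rewrite -/th; lra.
  by do !apply: Rmax_lub_lt; lra.
have m3 : th3 <= th by exact: Rmax_l.
have m1 : th1 <= th by apply: (Rle_trans _ (Rmax th1 th2)); [exact: Rmax_l | exact: Rmax_r].
have m2 : th2 <= th by apply: (Rle_trans _ (Rmax th1 th2)); exact: Rmax_r.
(* With [th ^ n = tau ^ n * tau ^ n], one factor [tau ^ n] survives after dividing by the weight
   given to the cost. *)
pose tau := sqrt th.
have tau2 : tau * tau = th by apply: sqrt_sqrt; lra.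
have tau0 : 0 < tau by apply: sqrt_lt_R0; lra.
have tau1 : tau < 1 by nra.
(* The divergence bound contributes [/ lam / ln 2]; the 2 counts the terms [th2 ^ n] and [th3 ^ n]
   of the error bound. *)
pose A := / lam / ln 2 + 2.
have A0 : 0 <= A.
  have : 0 < / lam / ln 2 by apply: Rdiv_lt_0_compat => //; exact: Rinv_0_lt_compat.
  by rewrite /A; lra.
pose mu := Eb PS b PV xf.
have Hn n : exists cn : code X S Y n (nsize n r) (nsize n RK),
    [/\ Ebn PS cn b <= mu + A * tau ^ n,
        0 <= Pe PS W cn <= (A + mu) * tau ^ n &
        0 <= kl (Phat PS W cn) (fun z => rprod (fun i => Q0 PS W x0 (z i)))
          <= (A + mu) * tau ^ n].
  have [M1 M2] := nsize_bounds n r; have [K1 _] := nsize_bounds n RK.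
  move: M1 M2 K1; set M := nsize n r; set K := nsize n RK; rewrite !Rpower2_pow => M1 M2 K1.
  have er : 0 < exp (r * ln 2) ^ n by apply: pow_lt; exact: exp_pos.
  have eK : 0 < exp (RK * ln 2) ^ n by apply: pow_lt; exact: exp_pos.
  (* The rate [r] may be negative; the message set is still nonempty, as a ceiling of a positive
     number. *)
  have M0 : (0 < M)%N by apply/ltP; apply: INR_lt; rewrite /=; lra.
  have K0 : (0 < K)%N by apply/ltP; apply: INR_lt; rewrite /=; lra.
  pose t := exp gam ^ n.
  have t0 : 0 < t by apply: pow_lt; exact: exp_pos.
  pose GY := extension (chanY PS W xf) (n:=n).
  pose GZ := extension (chanZ PS W xf) (n:=n).
  have HGY : forall v, is_pmf (GY v) by move=> v; exact: extension_is_pmf.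
  have HGZ : forall v, is_pmf (GZ v) by move=> v; exact: extension_is_pmf.
  have Hpn := prodpmf_is_pmf 'I_n HPV.
  pose cn (C : {ffun 'I_M * 'I_K -> {ffun 'I_n -> V}}) := strategy_code xf C (threshold_dec (prodpmf PV) GY (Ordinal M0) t C).
  pose klC C := kl (Phat PS W (cn C)) (fun z => rprod (fun i => Q0 PS W x0 (z i))).
  have outE : (fun z : {ffun 'I_n -> Z} => rprod (fun i => Q0 PS W x0 (z i))) =
      outpmf (prodpmf PV) GZ.
    apply: functional_extensionality => z; rewrite outpmf_extension.
    by apply: rprod_ext => i; rewrite -PZ_outpmf HZ.
  have out0 z : 0 < outpmf (prodpmf PV) GZ z.
    by rewrite outpmf_extension; exact: rprod_gt0.
  have LE : INR #|{: 'I_M * 'I_K}| = INR M * INR K by rewrite card_prod !card_ord mult_INR.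
  have HL : exp c ^ n <= INR #|{: 'I_M * 'I_K}|.
    rewrite LE /c Rmult_plus_distr_r exp_plus Rpow_mult_distr.
    by apply: Rmult_le_compat; lra.
  have Ekl : rsum (fun C => prodpmf (prodpmf PV) C * klC C) <= / lam / ln 2 * th1 ^ n.
    rewrite (@rsum_ext _ _ (fun C => prodpmf (prodpmf PV) C *
      kl (fun z => / INR #|{: 'I_M * 'I_K}| * rsum (fun l => GZ (C l) z))
        (outpmf (prodpmf PV) GZ))); last first.
      move=> C; rewrite /klC outE; congr (_ * kl _ _).
      by apply: functional_extensionality => z; exact: Phat_strategy_code.
    apply: (Rle_trans _ _ _ (soft_covering Hpn HGZ _ out0)).
      by rewrite card_prod !card_ord muln_gt0 M0 K0.
    have -> : / lam / ln 2 * th1 ^ n = / lam * th1 ^ n / ln 2 by field; lra.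
    by apply: Rmult_le_compat_r; [exact/Rlt_le/Rinv_0_lt_compat | exact: Hsoft].
  have Epe : rsum (fun C => prodpmf (prodpmf PV) C * Pe PS W (cn C)) <= th2 ^ n + th3 ^ n.
    rewrite (@rsum_ext _ _ (fun C => prodpmf (prodpmf PV) C *
      error_prob (prodpmf PV) GY (Ordinal M0) t C)); last first.
      by move=> C; rewrite /cn Pe_strategy_code.
    apply: (Rle_trans _ _ _ (random_coding Hpn HGY (Ordinal M0) (Ordinal K0) t0)).
    apply: Rplus_le_compat; first exact: Hthr.
    have -> : th3 ^ n = exp (r * ln 2) ^ n * / t.
      rewrite /t -pow_inv -Rpow_mult_distr -exp_Ropp -exp_plus.
      by congr (exp _ ^ _); ring.
    by apply: Rmult_le_compat_r => //; exact/Rlt_le/Rinv_0_lt_compat.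
  have Ecost := mean_Ebn HPS Hb xf HPV M0 K0
    (fun C => threshold_dec (prodpmf PV) GY (Ordinal M0) t C).
  have tn0 : 0 < tau ^ n by exact: pow_lt.
  have tn1 : tau ^ n <= 1 by rewrite -(pow1 n); apply: pow_incr; lra.
  have powle x : 0 <= x <= th -> x ^ n <= tau ^ n * tau ^ n.
    by move=> Hx; rewrite -Rpow_mult_distr tau2; exact: pow_incr.
  have p1 := powle th1 ltac:(lra); have p2 := powle th2 ltac:(lra).
  have p3 := powle th3 ltac:(lra).
  have Etot : rsum (fun C => prodpmf (prodpmf PV) C *
      (Pe PS W (cn C) + klC C + tau ^ n * Ebn PS (cn C) b)) <=
      tau ^ n * (A * tau ^ n + mu).
    rewrite (@rsum_ext _ _ (fun C => prodpmf (prodpmf PV) C * Pe PS W (cn C) +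
      prodpmf (prodpmf PV) C * klC C +
      tau ^ n * (prodpmf (prodpmf PV) C * Ebn PS (cn C) b))); last by move=> C; ring.
    rewrite !rsumD -rsum_mull.
    have H := Rmult_le_compat_l _ _ _ (Rlt_le _ _ tn0) Ecost.
    apply: (Rle_trans _ _ _ (Rplus_le_compat _ _ _ _ (Rplus_le_compat _ _ _ _ Epe Ekl) H)).
    have : / lam / ln 2 * th1 ^ n <= / lam / ln 2 * (tau ^ n * tau ^ n).
      apply: Rmult_le_compat_l => //; apply/Rlt_le/Rdiv_lt_0_compat => //.
      exact: Rinv_0_lt_compat.
    by rewrite /A -/mu; lra.
  (* One codebook meets the bound on the weighted sum. Since all three summands are nonnegative,
     each of them obeys it separately. *)
  have [C HC] := rsum_exists_le (prodpmf_is_pmf _ Hpn) Etot.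
  have Pe0 : 0 <= Pe PS W (cn C) by apply: Pe_ge0.
  have cost0 : 0 <= Ebn PS (cn C) b by apply: Ebn_ge0.
  have kl0 : 0 <= klC C.
    rewrite /klC outE; apply: kl_ge0 => //; first exact: Phat_is_pmf.
    exact: (outpmf_is_pmf Hpn HGZ).2.
  have mu0 : 0 <= mu.
    apply: Rle_trans Ecost; apply: rsum_ge0 => C'.
    by apply: Rmult_le_pos; [exact: (prodpmf_is_pmf _ Hpn).1 | apply: Ebn_ge0].
  have tc0 : 0 <= tau ^ n * Ebn PS (cn C) b by apply: Rmult_le_pos; lra.
  have HAmu : tau ^ n * (A * tau ^ n + mu) <= (A + mu) * tau ^ n.
    rewrite Rmult_comm; apply: Rmult_le_compat_r; first lra.
    by apply: Rplus_le_compat_r; rewrite -[X in _ <= X]Rmult_1_r; apply: Rmult_le_compat_l.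
  exists (cn C); split; [| by lra | by rewrite -/(klC C); lra].
  (* Cancelling the weight [tau ^ n] turns the common bound into cost at most [mu + A * tau ^ n]. *)
  by apply: (Rmult_le_reg_l (tau ^ n)) => //; lra.
(* Achievability asks for a function of [n], so a code is chosen for each blocklength. *)
pose cs n := proj1_sig (constructive_indefinite_description _ (Hn n)).
have Hcs n := proj2_sig (constructive_indefinite_description _ (Hn n)).
exists cs; split; last split.
- move=> e e0.
  have [N HN] : exists N, forall n, (n >= N)%coq_nat -> A * tau ^ n < e.
    have [N HN] := @cv0_geometric (fun n => A * tau ^ n) A tau ltac:(lra)
      (fun n => conj (Rmult_le_pos _ _ A0 (pow_le _ n (Rlt_le _ _ tau0))) (Rle_refl _)) e e0.
    exists N => n /HN; rewrite /R_dist Rminus_0_r => H.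
    exact: (Rle_lt_trans _ _ _ (Rle_abs _) H).
  exists N => n /leP /HN; rewrite /mu in Hcs.
  have H : Ebn PS (cs n) b <= Eb PS b PV xf + A * tau ^ n by have [] := Hcs n.
  by lra.
- by apply: (@cv0_geometric _ (A + mu) tau) => [|n]; [lra | have [] := Hcs n].
- by apply: (@cv0_geometric _ (A + mu) tau) => [|n]; [lra | have [] := Hcs n].
Qed.
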